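(* Let $\mathfrak{P}$ and $\mathfrak{Q}$ be topological properties such that - $\mathfrak{P}$ and $\mathfrak{Q}$ are closed hereditary; - a space with both $\mathfrak{P}$ and $\mathfrak{Q}$ is Lindelöf; - $\mathfrak{P}$ is preserved under countable closed sums; - a space with $\mathfrak{Q}$ having a dense subspace with $\mathfrak{P}$ has $\mathfrak{P}$. Let $X$ be a locally-$\mathfrak{P}$ space with $\mathfrak{Q}$. (1) Let $X$ be regular. Then $$C^{\mathfrak P}_0(X)=\{f\in C_B(X):\mathrm{supp}(f)\text{ has }\mathfrak{P}\}=C^{\mathfrak P}_{00}(X).$$ (2) Let $X$ be normal. Then $C^{\mathfrak P}_0(X)$ is a closed ideal of $C_B(X)$ isometrically isomorphic (as a normed algebra) to $C_0(Y)$ for some unique (up to homeomorphism) locally compact space $Y$, namely, for $Y=\lambda_{\mathfrak P}X$. In particular, $\lambda_{\mathfrak P}X$ is the spectrum of $C^{\mathfrak P}_0(X)$. Furthermore, $Y$ is countably compact; $C_0(Y)=C_{00}(Y)$; and the following are equivalent: $C^{\mathfrak P}_0(X)$ is unital; $X$ has $\mathfrak{P}$; $Y$ is compact.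
   Context: Completely regular, compact and locally compact spaces are assumed to be Hausdorff, and normal spaces are Hausdorff as well (hence completely regular). $C_B(X)$ is the normed algebra of continuous bounded $f:X\to\mathbb{C}$ with the supremum norm. For continuous $f:X\to\mathbb{C}$, $\mathrm{coz}(f)=X\setminus f^{-1}(0)$ and $\mathrm{supp}(f)=\mathrm{cl}_X\mathrm{coz}(f)$; $\mathrm{Coz}(X)$ is the set of all cozero-sets $\mathrm{coz}(f)$ of $X$. $C_{00}(Y)$ is the set of $f\in C_B(Y)$ with compact support, and $C_0(Y)$ is the set of $f\in C_B(Y)$ such that $|f|^{-1}([1/n,\infty))$ is compact for each positive integer $n$. $\beta X$ is the Stone–Čech compactification of $X$. A neighborhood of $A\subseteq X$ in $X$ is a set $U\subseteq X$ with $A\subseteq\mathrm{int}_XU$. The spectrum is the Gelfand spectrum (of a commutative $C^*$-algebra). A space is countably compact if every countable open cover has a finite subcover. A topological property $\mathfrak{P}$ is a homeomorphism-invariant property of spaces, always assumed non-empty (some space has $\mathfrak{P}$). $\mathfrak{P}$ is closed hereditary if any closed subspace of a space having $\mathfrak{P}$ also has $\mathfrak{P}$; it is preserved under countable closed sums if any space which is a countable (possibly finite) union of closed subspaces each having $\mathfrak{P}$ also has $\mathfrak{P}$. A space $X$ is locally-$\mathfrak{P}$ if each $x\in X$ has a neighborhood in $X$ with $\mathfrak{P}$. Let $\mathfrak{I}_{\mathfrak P}=\{A\subseteq X:\mathrm{cl}_XA\text{ has }\mathfrak{P}\}$, and call its elements null; when $\mathfrak{P}$ is closed hereditary and preserved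 under countable closed sums, this is an ideal of sets (closed under subsets and finite unions). Define $$C^{\mathfrak P}_{00}(X)=\{f\in C_B(X):\mathrm{supp}(f)\text{ has a null neighborhood in }X\},$$ $$C^{\mathfrak P}_0(X)=\{f\in C_B(X):|f|^{-1}([1/n,\infty))\text{ is null for each positive integer }n\},$$ and, for $X$ completely regular, $$\lambda_{\mathfrak P}X=\bigcup\{\mathrm{int}_{\beta X}\mathrm{cl}_{\beta X}C:C\in\mathrm{Coz}(X)\text{ and }\mathrm{cl}_XC\text{ has a null neighborhood in }X\}\subseteq\beta X.$$ An ideal of $C_B(X)$ is unital if, as an algebra, it has a multiplicative identity. *)

(* Defs.v *)
(* Spaces are arbitrary `topologicalType`s: they may be
   empty and no separation axiom is built in.  A subset `A : set T` regarded as
   a space is `set_type A`, which carries the subspace topology. *)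
From HB Require Import structures.
From mathcomp Require Import all_boot all_order all_algebra.
From mathcomp Require Import all_classical all_reals all_analysis.
From mathcomp Require Import complex.

Set Implicit Arguments.
Unset Strict Implicit.
Unset Printing Implicit Defensive.

Import Order.TTheory GRing.Theory Num.Theory.
Import numFieldNormedType.Exports.

Local Open Scope classical_set_scope.
Local Open Scope ring_scope.

(* The ascription makes the norm topology on R[i] inferable. *)
Definition CC (R : realType) : numClosedFieldType := R[i]%C.

Definition homeomorphic (S T : topologicalType) : Prop :=
  exists (f : S -> T) (g : T -> S),
    [/\ continuous f, continuous g, cancel f g & cancel g f].

Definition locally_compact_hausdorff (T : topologicalType) : Prop :=
  hausdorff_space T /\ locally_compact [set: T].

Definition open_cover (T : topologicalType) (G : set (set T)) : Prop :=
  G `<=` open /\ \bigcup_(A in G) A = [set: T].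

Definition lindelof (T : topologicalType) : Prop :=
  forall G : set (set T), open_cover G ->
    exists H : set (set T), [/\ H `<=` G, countable H & open_cover H].

Definition countably_compact (T : topologicalType) : Prop :=
  forall G : set (set T), countable G -> open_cover G ->
    exists H : set (set T), [/\ H `<=` G, finite_set H & open_cover H].

Definition topological_property (P : topologicalType -> Prop) : Prop :=
  (exists T, P T) /\ (forall S T, homeomorphic S T -> P S -> P T).

Definition closed_hereditary (P : topologicalType -> Prop) : Prop :=
  forall (T : topologicalType) (A : set T), closed A -> P T -> P (set_type A).

Definition countable_closed_sums (P : topologicalType -> Prop) : Prop :=
  forall (T : topologicalType) (G : set (set T)),
    countable G ->
    (forall A, G A -> closed A /\ P (set_type A)) ->
    \bigcup_(A in G) A = [set: T] ->
    P T.

Definition locally_prop (P : topologicalType -> Prop) (T : topologicalType) :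
    Prop :=
  forall x : T, exists2 U : set T, nbhs x U & P (set_type U).

Definition null (P : topologicalType -> Prop) (T : topologicalType)
    (A : set T) : Prop :=
  P (set_type (closure A)).

Definition has_null_nbhd (P : topologicalType -> Prop) (T : topologicalType)
    (A : set T) : Prop :=
  exists2 U : set T, set_nbhs A U & null P U.

Section FunctionAlgebras.
Variables (R : realType) (X : topologicalType).
Implicit Types f g : X -> CC R.

Definition CB : set (X -> CC R) :=
  [set f | continuous f /\ bounded_fun f].

(* `|f x| is an element of CC R; its real part is the modulus as an element of
   R.  On the empty space the norm of the only function is sup set0 = 0. *)
Definition supnorm f : R := sup (range (fun x => complex.Re `|f x|)).

Definition coz f : set X := [set x | f x != 0].

Definition supp f : set X := closure (coz f).

Definition Coz : set (set X) :=
  [set C | exists2 f : X -> CC R, continuous f & C = coz f].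

(* For a complex number z, the order of CC R makes a <= z mean that z - a is a
   nonnegative real. *)
Definition superlevel f (n : nat) : set X :=
  [set x | (n.+1%:R : CC R)^-1 <= `|f x|].

Definition C00 : set (X -> CC R) := [set f | CB f /\ compact (supp f)].

Definition C0 : set (X -> CC R) :=
  [set f | CB f /\ forall n, compact (superlevel f n)].

Definition C00P (P : topologicalType -> Prop) : set (X -> CC R) :=
  [set f | CB f /\ has_null_nbhd P (supp f)].

Definition C0P (P : topologicalType -> Prop) : set (X -> CC R) :=
  [set f | CB f /\ forall n, null P (superlevel f n)].

Definition CB_ideal (A : set (X -> CC R)) : Prop :=
  [/\ A `<=` CB,
      A (fun=> 0),
      (forall f g, A f -> A g -> A (f + g)) &
      (forall f g, CB f -> A g -> A (f * g))].

Definition CB_closed (A : set (X -> CC R)) : Prop :=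
  forall f, CB f ->
    (forall e : R, 0 < e -> exists2 g, A g & supnorm (f - g) < e) -> A f.

Definition unital (A : set (X -> CC R)) : Prop :=
  exists2 u, A u & forall f, A f -> u * f = f.

(* The algebra operations of A are those of X -> CC R, so the homomorphism laws
   are stated on the underlying functions.  No continuity is required: the
   characters of a commutative C*-algebra are automatically continuous. *)
Definition characters (A : set (X -> CC R)) :
    set {ptws (set_type A) -> CC R} :=
  [set chi | [/\ exists f : A, chi f != 0,
      (forall (a : CC R) (f g h : A),
         (set_val h : X -> CC R) = a *: (set_val f : X -> CC R) + set_val g ->
         chi h = a * chi f + chi g) &
      (forall f g h : A,
         (set_val h : X -> CC R) = (set_val f : X -> CC R) * set_val g ->
         chi h = chi f * chi g)]].
Arguments characters A : clear implicits.

(* On characters, the topology of pointwise convergence is the Gelfand (weak-* )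
   topology. *)
Definition spectrum (A : set (X -> CC R)) : topologicalType :=
  set_type (characters A).

(* The Stone-Cech compactification as the closure of the image of X under
   x |-> (f x)_f in the product of copies of the complex plane indexed by CB. *)
Definition stone_cech_eval (x : X) : {ptws (set_type CB) -> CC R} :=
  fun f : set_type CB => (set_val f : X -> CC R) x.

Definition stone_cech : topologicalType :=
  set_type (closure (range stone_cech_eval)).

Definition stone_cech_incl (x : X) : stone_cech :=
  exist _ (stone_cech_eval x)
    (mem_set (subset_closure (imageT stone_cech_eval x))).

Definition lambdaP (P : topologicalType -> Prop) : set stone_cech :=
  \bigcup_(C in [set C | Coz C /\ has_null_nbhd P (closure C)])
    interior (closure (stone_cech_incl @` C)).

End FunctionAlgebras.

Arguments CB R X : clear implicits.
Arguments C00 R X : clear implicits.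
Arguments C0 R X : clear implicits.
Arguments C00P R X P : clear implicits.
Arguments C0P R X P : clear implicits.
Arguments lambdaP R X P : clear implicits.

Definition isometrically_isomorphic (R : realType) (X Y : topologicalType)
    (A : set (X -> CC R)) (B : set (Y -> CC R)) : Prop :=
  exists phi : (X -> CC R) -> (Y -> CC R),
    [/\ set_bij A B phi,
        (forall f g, A f -> A g -> phi (f + g) = phi f + phi g),
        (forall a f, A f -> phi (a *: f) = a *: phi f),
        (forall f g, A f -> A g -> phi (f * g) = phi f * phi g) &
        (forall f, A f -> supnorm (phi f) = supnorm f)].

(* Main.v *)
(* By the hypotheses on P and Q, the union of a countable family of null sets is
   null: it contains a space with P that is dense in its closure.  Hence f lies
   in A = C0P exactly when its cozero-set is null.  A closed set C with P is
   Lindelof, so countably many null open sets cover it, and C has a null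
   neighborhood.

   Points of beta X are here the limits of evaluations on CB, so every f in CB
   has an extension y |-> y f to beta X, and lambda X is the set of those y
   with y f <> 0 for some f in A: Urysohn functions give one inclusion, the
   cozero-set of f itself the other.  Restricting extensions to lambda X maps A
   isometrically into C0.  It is onto because a compact subset of lambda X is
   covered by finitely many sets [y f <> 0], and so has a null trace on X.

   Every character of C0 Z is an evaluation, so any locally compact Hausdorff
   space Z with A isomorphic to C0 Z is the spectrum of A; this gives both the
   uniqueness of Y and its description as the spectrum.  Finally, for y_n in
   lambda X the sets coz f_n with y_n f_n <> 0 have a null union, on which some
   h in A equals 1; so all y_n lie in the compact set [|h| >= 1]. *)
Require Import Defs.
From HB Require Import structures.
From mathcomp Require Import all_boot all_order all_algebra.
From mathcomp Require Import all_classical all_reals all_analysis.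
From mathcomp Require Import complex lra.

Set Implicit Arguments.
Unset Strict Implicit.
Unset Printing Implicit Defensive.

Import Order.TTheory GRing.Theory Num.Theory.
Import numFieldNormedType.Exports.

Local Open Scope classical_set_scope.
Local Open Scope ring_scope.

(** * Subspaces and compactness *)

Lemma closed_preimage (S T : topologicalType) (f : S -> T) (D : set T) :
  continuous f -> closed D -> closed (f @^-1` D).
Proof. by move=> /continuous_closedP; apply. Qed.

Lemma open_preimage (S T : topologicalType) (f : S -> T) (D : set T) :
  continuous f -> open D -> open (f @^-1` D).
Proof. by move=> /continuousP; apply. Qed.

Lemma homeomorphic_sym (S T : topologicalType) :
  homeomorphic S T -> homeomorphic T S.
Proof. by move=> [f [g [cf cg fK gK]]]; exists g, f. Qed.

Lemma homeomorphic_trans (S T U : topologicalType) :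
  homeomorphic S T -> homeomorphic T U -> homeomorphic S U.
Proof.
move=> [f [g [cf cg fK gK]]] [f' [g' [cf' cg' fK' gK']]].
exists (f' \o f), (g \o g'); split.
- by move=> x; apply: continuous_comp; [exact: cf|exact: cf'].
- by move=> x; apply: continuous_comp; [exact: cg'|exact: cg].
- by move=> x /=; rewrite fK' fK.
- by move=> x /=; rewrite gK gK'.
Qed.

(** The last hypothesis says that [S] carries the topology induced by [f]; it makes the inverse,
    obtained by choice, continuous. *)
Lemma homeomorphic_embedding (S T : topologicalType) (f : S -> T) :
  continuous f -> injective f -> (forall y, exists x, f x = y) ->
  (forall x U, nbhs x U -> exists2 W, nbhs (f x) W & f @^-1` W `<=` U) ->
  homeomorphic S T.
Proof.
move=> cf fI fS fN; have [g gK] := choice fS.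
exists f, g; split => //; last by move=> x; apply: fI; rewrite gK.
move=> y U /= /fN[W]; rewrite gK => nW WU.
by apply: filterS nW => z Wz; apply: WU; rewrite /preimage/= gK.
Qed.

Lemma set_val_injective (T : Type) (A : set T) : injective (set_val : A -> T).
Proof. by move=> [x Ax] [y Ay] /= xy; apply: eq_sig_hprop. Qed.

Lemma in_set_type (T : Type) (A : set T) x : A x -> exists y : A, set_val y = x.
Proof. by move=> Ax; exists (exist _ x (mem_set Ax)). Qed.

Section subspaces.
Variables (X : topologicalType) (A : set X).

Lemma set_val_continuous : continuous (set_val : A -> X).
Proof. exact: initial_continuous. Qed.

Lemma set_type_nbhs (x : A) (U : set A) :
  nbhs x U -> exists2 W, nbhs (set_val x) W & set_val @^-1` W `<=` U.
Proof.
move=> [_ [[W oW <-]] Wx WU]; exists W => //.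
exact: open_nbhs_nbhs.
Qed.

Lemma continuous_set_val (T : topologicalType) (f : T -> A) :
  continuous (set_val \o f) -> continuous f.
Proof.
move=> cf x U /set_type_nbhs[W nW WU].
have nfW : nbhs x ((set_val \o f) @^-1` W) := cf x W nW.
by apply: filterS nfW => y; apply: WU.
Qed.

Lemma compact_set_type (K : set X) : compact K -> K `<=` A ->
  compact ((set_val : A -> X) @^-1` K).
Proof.
move=> cK KA F PF FK.
have [x [Kx Fx]] := cK (set_val @ F) _ FK.
have [y yx] := in_set_type (KA _ Kx).
exists y; split; first by rewrite /preimage /= yx.
move=> U V FU /set_type_nbhs[W nW WV].
have FU' : (set_val @ F) (set_val @` U).
  by apply: (@filterS _ F _ U) => // z Uz; exists z.
have [_ [[z Uz <-] Wz]] : set_val @` U `&` W !=set0.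
  by apply: Fx => //; rewrite -yx.
by exists z; split => //; apply: WV.
Qed.

End subspaces.

Lemma homeomorphic_setT (X : topologicalType) :
  homeomorphic (set_type [set: X]) X.
Proof.
apply: (@homeomorphic_embedding _ _ set_val).
- exact: set_val_continuous.
- exact: set_val_injective.
- by move=> x; apply: in_set_type.
- exact: set_type_nbhs.
Qed.

(** Closed heredity and closed sums produce subspaces of subspaces; this turns them into subspaces
    of [X], up to a homeomorphism that [P] respects. *)
Lemma homeomorphic_subset (X : topologicalType) (A B : set X) : B `<=` A ->
  homeomorphic (set_type ((set_val : A -> X) @^-1` B)) B.
Proof.
move=> BA; set B' := (_ @^-1` _).
pose f (x : B') : B := exist _ (set_val (set_val x)) (mem_set (set_valP x)).
apply: (@homeomorphic_embedding _ _ f).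
- apply: continuous_set_val => x.
  by apply: (@continuous_comp _ _ _ set_val set_val); exact: set_val_continuous.
- move=> x y fxy; do 2 apply: set_val_injective.
  exact: (congr1 set_val fxy).
- move=> y; have [x xy] := in_set_type (BA _ (set_valP y)).
  have B'x : B' x by rewrite /B' /preimage/= xy; exact: set_valP.
  exists (exist _ x (mem_set B'x)); apply: set_val_injective.
  exact: xy.
- move=> x U /set_type_nbhs[V /set_type_nbhs[W nW WV] VU].
  exists (set_val @^-1` W); first exact: set_val_continuous.
  by move=> y Wy; apply: VU; apply: WV.
Qed.

(* The relative complements in [K] of the sets of a proper ideal generate a
   filter, whose cluster points cannot have a neighborhood in the ideal. *)
Lemma compact_ideal (X : topologicalType) (I : set (set X)) (K : set X) :
  I set0 -> (forall A B, A `<=` B -> I B -> I A) ->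
  (forall A B, I A -> I B -> I (A `|` B)) ->
  compact K -> (forall x, K x -> exists2 U, nbhs x U & I U) -> I K.
Proof.
move=> I0 IS IU cK Kloc; apply: contrapT => nIK.
pose F : set_system X := [set S | I (K `\` S)].
have FF : ProperFilter F.
  split; first by rewrite /F /= setD0.
  split.
  - by rewrite /F /= setDT.
  - move=> S T IS' IT; rewrite /F /= setDIr; exact: IU.
  - by move=> S T ST; apply: IS; apply: setDS.
have FK : F K by rewrite /F /= setDv.
have [x [Kx Fx]] := cK F FF FK.
have [U nU IU'] := Kloc x Kx.
have FCU : F (~` U) by apply: IS IU' => y [_ /=]; exact: contrapT.
by have [y []] := Fx _ _ FCU nU.
Qed.

Lemma hausdorff_injective (S T : topologicalType) (f : S -> T) :
  continuous f -> injective f -> hausdorff_space T -> hausdorff_space S.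
Proof.
move=> cf fI hT x y xy; apply: fI; apply: hT => U V nU nV.
have [z [Uz Vz]] := xy _ _ (cf x U nU) (cf y V nV).
by exists (f z).
Qed.

(** * Complex-valued functions *)

Section modulus.
Variable R : realType.
Implicit Types z w : CC R.

(** The norm of [CC R] has values in [CC R]; its real part brings estimates into the totally ordered
    field [R]. *)
Definition modulus z : R := complex.Re `|z|.

Lemma modulusE z : `|z| = (modulus z)%:C%C :> CC R.
Proof. by rewrite /modulus normc_def. Qed.

Lemma modulus_ge0 z : 0 <= modulus z.
Proof. by have := normr_ge0 z; rewrite modulusE ler0c. Qed.

Lemma modulus0 : modulus 0 = 0.
Proof. by rewrite /modulus normr0. Qed.

Lemma modulus1 : modulus 1 = 1.
Proof. by rewrite /modulus normr1. Qed.

Lemma modulus_real (a : R) : modulus a%:C%C = `|a|.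
Proof. by rewrite /modulus normc_def /= expr0n addr0 sqrtr_sqr. Qed.

Lemma modulus_eq0 z : modulus z = 0 -> z = 0.
Proof. by move=> z0; apply: normr0_eq0; rewrite modulusE z0. Qed.

Lemma modulusM z w : modulus (z * w) = modulus z * modulus w.
Proof. by apply: complexI; rewrite rmorphM/= -!modulusE normrM. Qed.

Lemma modulusD z w : modulus (z + w) <= modulus z + modulus w.
Proof.
rewrite -lecR rmorphD/= -[(modulus z)%:C%C]modulusE.
rewrite -[(modulus w)%:C%C]modulusE -[(modulus (z + w))%:C%C]modulusE.
exact: ler_normD.
Qed.

Lemma modulusN z : modulus (- z) = modulus z.
Proof. by rewrite /modulus normrN. Qed.

Lemma modulusB z w : modulus (z - w) = modulus (w - z).
Proof. by rewrite -modulusN opprB. Qed.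

Lemma modulus_conj z : modulus z^*%R = modulus z.
Proof. by rewrite /modulus norm_conjC. Qed.

Lemma modulusV z : modulus z^-1 = (modulus z)^-1.
Proof. by apply: complexI; rewrite fmorphV/= -!modulusE normfV. Qed.

Lemma modulus_mul_conj z : z * z^*%R = (modulus z ^+ 2)%:C%C.
Proof. by rewrite -normCK modulusE rmorphXn. Qed.

Lemma ler_inv_nat_modulus n z :
  ((n.+1%:R : CC R)^-1 <= `|z|) = (n.+1%:R^-1 <= modulus z).
Proof. by rewrite modulusE -lecR fmorphV/= rmorph_nat. Qed.

(** Balls of [CC R] have radii in [CC R], but a radius that is positive for the complex order has
    zero imaginary part. *)
Lemma nbhs_modulus z (U : set (CC R)) :
  nbhs z U <-> exists2 e : R, 0 < e & forall w, modulus (z - w) < e -> U w.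
Proof.
split.
  case/nbhs_ballP => e /= e0 eU; exists (complex.Re e).
    by move: e0; rewrite ltcE => /andP[].
  move=> w zw; apply: eU; rewrite -ball_normE /=.
  rewrite modulusE ltcE zw andbT /=.
  by move: e0; rewrite ltcE => /andP[/eqP ->].
move=> [e e0 eU]; apply/nbhs_ballP; exists (e%:C%C : CC R) => /=.
  by rewrite ltcR.
by move=> w; rewrite -ball_normE /= modulusE ltcR; exact: eU.
Qed.

Lemma modulus_continuous : continuous modulus.
Proof.
move=> z U /= /nbhs_ballP[e /= e0 eU]; apply/nbhs_modulus; exists e => // w zw.
apply: eU; rewrite -ball_normE /=; apply: le_lt_trans zw.
rewrite ler_norml; apply/andP; split.
  rewrite lerNl opprB lerBlDr modulusB.
  by apply: le_trans (modulusD _ _); rewrite subrK.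
by rewrite lerBlDr; apply: le_trans (modulusD _ _); rewrite subrK.
Qed.

Lemma conj_continuous : continuous (fun z => z^*%R).
Proof.
move=> z U /= /nbhs_modulus[e e0 eU]; apply/nbhs_modulus; exists e => // w zw.
by apply: eU; rewrite -rmorphB/= modulus_conj.
Qed.

Lemma real_complex_continuous : continuous (fun a : R => a%:C%C : CC R).
Proof.
move=> a U /= /nbhs_modulus[e e0 eU]; apply/nbhs_ballP; exists e => // b.
by rewrite -ball_normE /= => ab; apply: eU; rewrite -rmorphB/= modulus_real.
Qed.

(** The disc is closed and lies in the continuous image of a compact square. *)
Lemma compact_disc (M : R) : compact [set z | modulus z <= M].
Proof.
pose f (p : R * R) : CC R := p.1%:C%C + 'i%C * p.2%:C%C.
have cf : continuous f.
  move=> p; apply: (@cvgD _ (CC R)).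
    by apply: (continuous_comp cvg_fst); exact: real_complex_continuous.
  apply: (@cvgM (CC R)); first exact: cvg_cst.
  by apply: (continuous_comp cvg_snd); exact: real_complex_continuous.
apply: (@subclosed_compact _ _
  (f @` (`[- M, M]%classic `*` `[- M, M]%classic))).
- exact: (closed_preimage modulus_continuous (@closed_le R M)).
- apply: continuous_compact; first exact: continuous_subspaceT.
  by apply: compact_setX; exact: segment_compact.
- move=> z /= zM; exists (complex.Re z, complex.Im z); last first.
    by rewrite /f [RHS]complexE.
  have bnd (a b : R) : `|a| <= Num.sqrt (a ^+ 2 + b ^+ 2).
    by rewrite -sqrtr_sqr ler_wsqrtr// lerDl sqr_ge0.
  have zE : modulus z = Num.sqrt ((complex.Re z) ^+ 2 + (complex.Im z) ^+ 2).
    by rewrite /modulus normc_def.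
  split; rewrite /= in_itv/= -ler_norml; apply: le_trans zM; rewrite zE //.
  by rewrite addrC.
Qed.

Section continuous_operations.
Variable T : topologicalType.
Implicit Types f g : T -> CC R.

Lemma continuous_add f g : continuous f -> continuous g ->
  continuous (fun x => f x + g x).
Proof.
by move=> cf cg x; apply: (@cvgD _ (CC R)); [exact: cf|exact: cg].
Qed.

Lemma continuous_sub f g : continuous f -> continuous g ->
  continuous (fun x => f x - g x).
Proof.
by move=> cf cg x; apply: (@cvgB _ (CC R)); [exact: cf|exact: cg].
Qed.

Lemma continuous_mul f g : continuous f -> continuous g ->
  continuous (fun x => f x * g x).
Proof.
by move=> cf cg x; apply: (@cvgM (CC R)); [exact: cf|exact: cg].
Qed.

Lemma continuous_modulus f :
  continuous f -> continuous (fun x => modulus (f x)).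
Proof.
by move=> cf x; apply: continuous_comp; [exact: cf|exact: modulus_continuous].
Qed.

End continuous_operations.

Lemma closed_set1C (a : CC R) : closed [set a].
Proof.
exact/accessible_closed_set1/hausdorff_accessible/(@norm_hausdorff _ (CC R)).
Qed.

End modulus.

(** * Bounded continuous functions and the supremum norm *)

Section bounded_functions.
Variables (R : realType) (X : topologicalType).
Implicit Types (f g : X -> CC R) (A : set (X -> CC R)).

Lemma CBP f : CB R X f <->
  continuous f /\ exists M : R, forall x, modulus (f x) <= M.
Proof.
split=> [[cf [M [Mreal fM]]]|[cf [M fM]]].
  (* [bounded_fun] only promises bounds strictly above [M], hence [M + 1]. *)
  split => //; exists (complex.Re (M + 1)) => x.
  have MM1 : M < M + 1 by rewrite ltrDl.
  have : `|f x : CC R| <= M + 1 := fM _ MM1 x I.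
  by rewrite modulusE lecE => /andP[].
split => //; exists (M%:C%C); split; first by apply/complex_realP; exists M.
move=> N MN x _; apply: le_trans (ltW MN).
by rewrite modulusE lecR.
Qed.

Lemma CB_continuous f : CB R X f -> continuous f.
Proof. by move=> []. Qed.

Lemma CB_bounded f : CB R X f -> exists M : R, forall x, modulus (f x) <= M.
Proof. by move=> /CBP[]. Qed.

Lemma CB_cst (a : CC R) : CB R X (fun=> a).
Proof. by apply/CBP; split; [exact: cst_continuous|exists (modulus a)]. Qed.

Lemma CBD f g : CB R X f -> CB R X g -> CB R X (f + g).
Proof.
move=> /CBP[cf [M fM]] /CBP[cg [N gN]]; apply/CBP; split.
  exact: continuous_add.
by exists (M + N) => x; apply: le_trans (modulusD _ _) _; rewrite lerD.
Qed.

Lemma CBM f g : CB R X f -> CB R X g -> CB R X (f * g).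
Proof.
move=> /CBP[cf [M fM]] /CBP[cg [N gN]]; apply/CBP; split.
  exact: continuous_mul.
by exists (M * N) => x; rewrite modulusM ler_pM// modulus_ge0.
Qed.

Lemma CB_conj f : CB R X f -> CB R X (fun x => (f x)^*%R).
Proof.
move=> /CBP[cf [M fM]]; apply/CBP; split.
  by move=> x; apply: continuous_comp; [exact: cf|exact: conj_continuous].
by exists M => x; rewrite modulus_conj.
Qed.

Lemma CB_sum_sqr f g : CB R X f -> CB R X g ->
  CB R X (fun x => f x * (f x)^*%R + g x * (g x)^*%R).
Proof.
by move=> Cf Cg; apply: CBD; apply: CBM => //; exact: CB_conj.
Qed.

(* On the empty space both sides reduce to [0 <= M]. *)
Lemma supnorm_leP f (M : R) : CB R X f ->
  supnorm f <= M <-> 0 <= M /\ forall x, modulus (f x) <= M.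
Proof.
move=> /CB_bounded[N fN]; split=> [fM|[M0 fM]].
  have fM' x : modulus (f x) <= M.
    apply: le_trans fM; apply: ub_le_sup; last by exists x.
    by exists N => _ [y _ <-]; exact: fN.
  split => //; have [X0|/set0P[x _]] := eqVneq [set: X] set0.
    by move: fM; rewrite /supnorm X0 image_set0 sup0.
  exact: le_trans (modulus_ge0 (f x)) (fM' x).
have [X0|/set0P[x _]] := eqVneq [set: X] set0.
  by rewrite /supnorm X0 image_set0 sup0.
apply: ge_sup; first by exists (modulus (f x)), x.
by move=> _ [y _ <-]; exact: fM.
Qed.

End bounded_functions.

(** * Superlevel sets, cozero-sets and the ideal [C0] *)

Section superlevel_sets.
Variables (R : realType) (X : topologicalType).
Implicit Types (f g : X -> CC R).

Lemma superlevelP f n x : superlevel f n x <-> n.+1%:R^-1 <= modulus (f x).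
Proof. by rewrite /superlevel/= ler_inv_nat_modulus. Qed.

Lemma superlevel_closed f n : continuous f -> closed (superlevel f n).
Proof.
move=> cf; have -> : superlevel f n =
    (@modulus R \o f) @^-1` [set a | n.+1%:R^-1 <= a].
  by apply/seteqP; split=> x /superlevelP.
by apply: closed_preimage; [exact: continuous_modulus|exact: closed_ge].
Qed.

Lemma coz_open f : continuous f -> open (coz f).
Proof.
move=> cf; have -> : coz f = f @^-1` ~` [set 0].
  by apply/seteqP; split=> x /= /eqP.
apply: open_preimage cf _; apply: closed_openC.
exact: closed_set1C.
Qed.

Lemma coz_superlevel f : coz f = \bigcup_n superlevel f n.
Proof.
apply/seteqP; split=> x /=.
  move=> fx; have fx0 : 0 < modulus (f x).
    rewrite lt_neqAle modulus_ge0 andbT eq_sym; apply: contra fx => /eqP.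
    by move=> /modulus_eq0 ->.
  have [n] := ltr_add_invr fx0; rewrite add0r => nfx.
  by exists n => //; apply/superlevelP; exact: ltW.
move=> [n _ /superlevelP nfx]; rewrite /coz/=; apply/eqP => fx.
by move: nfx; rewrite fx modulus0 invr_le0 lern0.
Qed.

Lemma superlevel_supp f n : superlevel f n `<=` supp f.
Proof.
move=> x nfx; apply: subset_closure; rewrite coz_superlevel.
by exists n.
Qed.

(** The index [n.*2.+1] stands for the level [1/(2n+2)], half of [1/(n+1)]. *)
Lemma superlevelD f g n :
  superlevel (f + g) n `<=`
  superlevel f (n.*2.+1) `|` superlevel g (n.*2.+1).
Proof.
move=> x /superlevelP nfg.
have E : n.+1%:R^-1 = n.*2.+2%:R^-1 + n.*2.+2%:R^-1 :> R.
  by rewrite -doubleS -muln2 natrM invfM -splitr.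
have [nf|nf] := leP (n.*2.+2%:R^-1) (modulus (f x)).
  by left; apply/superlevelP.
right; apply/superlevelP; rewrite -(lerD2l (n.*2.+2%:R^-1)) -E.
apply: le_trans nfg _; apply: le_trans (modulusD _ _) _.
by rewrite lerD2r ltW.
Qed.

Lemma superlevelM f g n : CB R X f ->
  exists m, superlevel (f * g) n `<=` superlevel g m.
Proof.
move=> /CB_bounded[M fM].
(* The bound [M] may be zero, or negative when [X] is empty; [|M| + 1] is a positive bound. *)
have K0 : 0 < n.+1%:R^-1 / (`|M| + 1) :> R by rewrite divr_gt0// ltr_wpDl.
have [m] := ltr_add_invr K0; rewrite add0r => mK.
exists m => x /superlevelP nfg; apply/superlevelP.
apply: le_trans (ltW mK) _; rewrite ler_pdivrMr ?ltr_wpDl//.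
apply: le_trans nfg _; rewrite modulusM mulrC ler_wpM2l ?modulus_ge0//.
by apply: le_trans (fM x) _; rewrite (le_trans (ler_norm M))// lerDl.
Qed.

Lemma C0_ideal : CB_ideal (C0 R X).
Proof.
split.
- by move=> f [].
- split=> [|n]; first exact: CB_cst.
  suff -> : superlevel (fun=> 0 : CC R) n = set0 :> set X by exact: compact0.
  apply/seteqP; split => // x /superlevelP.
  by rewrite modulus0 invr_le0 lern0.
- move=> f g [Cf cf] [Cg cg]; have Cfg := CBD Cf Cg; split=> // n.
  apply: subclosed_compact (compactU (cf _) (cg _)) (@superlevelD f g n).
  exact/superlevel_closed/CB_continuous.
- move=> f g Cf [Cg cg]; have Cfg := CBM Cf Cg; split=> // n.
  have [m nm] := superlevelM g n Cf.
  apply: subclosed_compact (cg m) nm.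
  exact/superlevel_closed/CB_continuous.
Qed.

End superlevel_sets.

(** * Null sets *)

Lemma uniform_separator_CB (R : realType) (X : topologicalType) (A B : set X) :
  uniform_separator A B ->
  exists u : X -> CC R, [/\ CB R X u, forall x, A x -> u x = 1 &
                            forall x, B x -> u x = 0].
Proof.
move=> /(@uniform_separatorP _ R)[v [cv v01 v0 v1]].
(* The separator [v] is 0 on [A] and 1 on [B], the reverse of what is wanted. *)
exists (fun x => (1 - v x)%:C%C); split.
- apply/CBP; split.
    move=> x; apply: (@continuous_comp _ _ _ (fun x => 1 - v x)).
      by apply: cvgB; [exact: cvg_cst|exact: cv].
    exact: real_complex_continuous.
  exists 1 => x; rewrite modulus_real.
  have /= := v01 (v x) (imageT _ _); rewrite in_itv/= => /andP[v0x v1x].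
  by rewrite ger0_norm ?subr_ge0// gerBl.
- by move=> x Ax; have -> : v x = 0; [apply: v0; exists x|rewrite subr0].
- by move=> x Bx; have -> : v x = 1; [apply: v1; exists x|rewrite subrr].
Qed.

Section null_sets.
Variables (P Q : topologicalType -> Prop).
Hypothesis P_prop : topological_property P.
Hypotheses (P_hered : closed_hereditary P) (Q_hered : closed_hereditary Q).
Hypothesis PQ_lindelof : forall T : topologicalType, P T -> Q T -> lindelof T.
Hypothesis P_sums : countable_closed_sums P.
Hypothesis PQ_dense : forall (T : topologicalType) (D : set T),
  Q T -> dense D -> P (set_type D) -> P T.
Variable X : topologicalType.
Hypotheses (X_locP : locally_prop P X) (X_Q : Q X).
Implicit Types A B : set X.

Lemma closed_subset_prop A B : closed B -> B `<=` A -> P A -> P B.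
Proof.
move=> cB BA PA; apply: P_prop.2 (homeomorphic_subset BA) _.
by apply: P_hered PA; apply: closed_preimage cB; exact: set_val_continuous.
Qed.

Lemma null_closed A : closed A -> null P A <-> P A.
Proof. by move=> /closure_id AE; rewrite /null -AE. Qed.

Lemma null_subset A B : A `<=` B -> null P B -> null P A.
Proof.
move=> AB; apply: closed_subset_prop; first exact: closed_closure.
exact: closureS.
Qed.

Lemma bigcup_closed_prop (G : set (set X)) : countable G ->
  (forall A, G A -> closed A /\ P A) -> P (\bigcup_(A in G) A).
Proof.
move=> Gc GP; set U := \bigcup_(A in G) A.
apply: (P_sums (G := (fun A => (set_val : U -> X) @^-1` A) @` G)).
- exact: sub_countable (card_image_le _ _) Gc.
- move=> _ [A GA <-]; have [cA PA] := GP _ GA; split.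
    by apply: closed_preimage cA; exact: set_val_continuous.
  apply: P_prop.2 (homeomorphic_sym (homeomorphic_subset _)) PA.
  exact: bigcup_sup.
- apply/seteqP; split => // x _; have [A GA Ax] := set_valP x.
  by exists (set_val @^-1` A) => //; exists A.
Qed.

(** The union [V] of the closures of the [F i] has [P] by closed sums. It lies between [U] and
    [closure U], so it is dense in [closure U], which has [Q] as a closed subspace; hence
    [closure U] has [P]. *)
Lemma null_bigcup (I : Type) (D : set I) (F : I -> set X) : countable D ->
  (forall i, D i -> null P (F i)) -> null P (\bigcup_(i in D) F i).
Proof.
move=> Dc FP; set U := \bigcup_(i in D) F i.
pose V := \bigcup_(A in (closure \o F) @` D) A.
have UV : U `<=` V.
  move=> x [i Di Fx]; exists (closure (F i)); first by exists i.
  exact: subset_closure.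
have VU : V `<=` closure U.
  by move=> x [_ [i Di <-]]; apply: closureS x; exact: bigcup_sup.
have PV : P V.
  apply: bigcup_closed_prop; first exact: sub_countable (card_image_le _ _) Dc.
  by move=> _ [i Di <-]; split; [exact: closed_closure|exact: FP].
apply: (PQ_dense (D := (set_val : closure U -> X) @^-1` V)).
- by apply: Q_hered X_Q; exact: closed_closure.
- move=> O [x Ox] [W oW WO].
  have Wx : W (set_val x) by rewrite -WO in Ox.
  have [y [Uy Wy]] := set_valP x W (open_nbhs_nbhs (conj oW Wx)).
  have [z zy] := in_set_type (VU _ (UV _ Uy)).
  by exists z; rewrite -WO /preimage/= zy; split => //; exact: UV.
- exact: P_prop.2 (homeomorphic_sym (homeomorphic_subset VU)) PV.
Qed.

Lemma null0 : null P (set0 : set X).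
Proof. by rewrite -(bigcup_set0 (fun A : set X => A)); exact: null_bigcup. Qed.

Lemma nullU A B : null P A -> null P B -> null P (A `|` B).
Proof.
move=> PA PB; rewrite -bigcup2E.
by apply: null_bigcup => // -[|[|n]] _ //=; exact: null0.
Qed.

Variable R : realType.
Implicit Types f g : X -> CC R.

(** [P (supp f)] is by definition the nullity of [coz f], and [coz f] is the countable union of the
    superlevel sets. *)
Lemma C0P_supp : C0P R X P = [set f | CB R X f /\ P (supp f)].
Proof.
apply/seteqP; split=> f [Cf Pf]; split => //.
  rewrite /supp coz_superlevel; exact: null_bigcup.
move=> n; apply: null_subset (@superlevel_supp _ _ f n) _.
by apply/null_closed => //; exact: closed_closure.
Qed.

Hypothesis X_regular : regular_space X.

(** By regularity each point of [A] has an open neighborhood whose closure lies in a set with [P].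
    The traces of these on [A] have a countable subcover, as [A] has both [P] and [Q], and a
    countable union of null sets is null. *)
Lemma closed_prop_null_nbhd A : closed A -> P A -> has_null_nbhd P A.
Proof.
move=> cA PA.
have QA : Q A by exact: Q_hered X_Q.
pose G : set (set A) := [set S | exists V : set X,
  [/\ open V, P (closure V) & S = set_val @^-1` V]].
have [] := PQ_lindelof PA QA (G := G).
  split; first by move=> _ [V [oV _ ->]]; exists V.
  apply/seteqP; split => // x _.
  have [U nU PU] := X_locP (set_val x).
  have [V nV VU] := X_regular nU.
  exists (set_val @^-1` V°); last exact: nV.
  exists V°; split => //; first exact: open_interior.
  apply: closed_subset_prop PU; first exact: closed_closure.
  by apply: subset_trans VU; apply: closureS; exact: interior_subset.
move=> H [HG Hc [_ HT]].
(* Each trace in [H] gets back an open null set of [X] that cuts it out; outside [H] the value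
   [set0] is a dummy. *)
have /choice[f fP] : forall S : set A, exists V : set X, H S ->
    [/\ open V, P (closure V) & S = set_val @^-1` V].
  move=> S; have [/HG[V HV]|nHS] := pselect (H S); first by exists V.
  by exists set0.
exists (\bigcup_(S in H) f S).
- move=> x Ax; have [y yx] := in_set_type Ax.
  have [S HS Sy] : (\bigcup_(S in H) S) y by rewrite HT.
  have [oV _ SE] := fP S HS.
  apply: (@filterS _ _ _ (f S)); first exact: bigcup_sup.
  by apply: open_nbhs_nbhs; split => //; rewrite -yx; rewrite SE in Sy.
- by apply: null_bigcup => // S /fP[].
Qed.


Lemma C00P_supp : C00P R X P = [set f | CB R X f /\ P (supp f)].
Proof.
apply/seteqP; split=> f [Cf].
  move=> [U nU PU]; split=> //; apply: closed_subset_prop PU.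
    exact: closed_closure.
  by move=> x fx; apply: subset_closure; exact: nbhs_singleton (nU x fx).
move=> Pf; split => //; apply: closed_prop_null_nbhd => //.
exact: closed_closure.
Qed.

End null_sets.

(** * Characters of C0 Z *)

Section character_theory.
Variables (R : realType) (X : topologicalType).
Implicit Types (f g h : X -> CC R) (A : set (X -> CC R)).

Lemma idealZ A (a : CC R) f : CB_ideal A -> A f -> A (a *: f).
Proof. by move=> [_ _ _ AM] Af; apply: (AM (fun=> a)) => //; exact: CB_cst. Qed.

(** Characters and points of the Stone-Cech compactification are functions on a subtype; extension
    by zero lets them be applied to plain functions. *)
Definition ext0 A (chi : set_type A -> CC R) f : CC R :=
  match pselect (A f) with
  | left Af => chi (exist _ f (mem_set Af))
  | right _ => 0
  end.

Lemma ext0_val A (chi : set_type A -> CC R) (f : A) :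
  ext0 chi (set_val f) = chi f.
Proof.
rewrite /ext0; case: pselect => [Af|]; last by case; exact: set_valP.
by congr chi; exact: set_val_injective.
Qed.

Definition is_character A (chi : (X -> CC R) -> CC R) : Prop :=
  [/\ exists2 f, A f & chi f != 0,
      forall (a : CC R) f g, A f -> A g ->
        chi (a *: f + g) = a * chi f + chi g &
      forall f g, A f -> A g -> chi (f * g) = chi f * chi g].

(** The laws in [characters] speak of a third element of [A] equal to the combination or product;
    the ideal property supplies that element. *)
Lemma characters_ext0 A (chi : {ptws (set_type A) -> CC R}) : CB_ideal A ->
  @characters R X A chi <-> is_character A (ext0 chi).
Proof.
move=> Aid; have [ACB _ AD AM] := Aid; split.
- move=> [[k k0] lin mul]; split.
  + by exists (set_val k); [exact: set_valP|rewrite ext0_val].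
  + move=> a f g Af Ag.
    have [u uf] := in_set_type Af; have [v vg] := in_set_type Ag.
    have [w wfg] := in_set_type (AD _ _ (idealZ a Aid Af) Ag).
    by rewrite -wfg -uf -vg !ext0_val; apply: lin; rewrite wfg uf vg.
  + move=> f g Af Ag.
    have [u uf] := in_set_type Af; have [v vg] := in_set_type Ag.
    have [w wfg] := in_set_type (AM _ _ (ACB _ Af) Ag).
    by rewrite -wfg -uf -vg !ext0_val; apply: mul; rewrite wfg uf vg.
- move=> [[k Ak k0] lin mul]; split.
  + by have [u uk] := in_set_type Ak; exists u; rewrite -ext0_val uk.
  + by move=> a f g h hE; rewrite -!ext0_val hE lin//; exact: set_valP.
  + by move=> f g h hE; rewrite -!ext0_val hE mul//; exact: set_valP.
Qed.

Section characters_C0.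
Variable chi : (X -> CC R) -> CC R.
Hypothesis chi_char : is_character (C0 R X) chi.

Let chi_lin : forall (a : CC R) f g, C0 R X f -> C0 R X g ->
  chi (a *: f + g) = a * chi f + chi g.
Proof. by case: chi_char. Qed.

Let chi_mul : forall f g, C0 R X f -> C0 R X g -> chi (f * g) = chi f * chi g.
Proof. by case: chi_char. Qed.

Let ideal := C0_ideal R X.

Let C0M f g : CB R X f -> C0 R X g -> C0 R X (f * g).
Proof. by case: ideal => _ _ _; apply. Qed.

Let C0_0 : C0 R X 0.
Proof. by case: ideal. Qed.

Let chi0 : chi 0 = 0.
Proof.
have := chi_lin 1 C0_0 C0_0; rewrite scale1r add0r mul1r => /esym/eqP.
by rewrite -[X in _ == X]addr0 (inj_eq (addrI _)) => /eqP.
Qed.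

Let chiZ (a : CC R) f : C0 R X f -> chi (a *: f) = a * chi f.
Proof. by move=> Cf; rewrite -[a *: f]addr0 chi_lin// chi0 addr0. Qed.

Let normalized : exists2 f, C0 R X f & chi f = 1.
Proof.
have [[f Cf f0] _ _] := chi_char; exists ((chi f)^-1 *: f).
  exact: idealZ.
by rewrite chiZ// mulVf.
Qed.

(* [p] extends [chi] to a character of [CB X].  The sets [|h| < 1] with
   [p h = 0] form a filter base, since an [h] without such points would be
   invertible; the filter contains the compact set [|f0| >= 1/2], and
   [chi] is the evaluation at any of its cluster points. *)
Lemma character_C0_eval : exists z, forall f, C0 R X f -> chi f = f z.
Proof.
have [f0 Cf0 chif0] := normalized.
pose p g := chi (g * f0).
have pD g h : CB R X g -> CB R X h -> p (g + h) = p g + p h.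
  move=> Cg Ch; rewrite /p mulrDl.
  by rewrite -[g * f0]scale1r chi_lin ?mul1r ?scale1r//; exact: C0M.
have pM g h : CB R X g -> CB R X h -> p (g * h) = p g * p h.
  move=> Cg Ch; rewrite /p -chi_mul; [|exact: C0M..].
  (* The surplus factor [f0] disappears because [chi f0 = 1]. *)
  rewrite (_ : g * f0 * (h * f0) = (g * h * f0) * f0); last first.
    by rewrite mulrACA mulrA.
  by rewrite [RHS]chi_mul ?chif0 ?mulr1//; apply: C0M => //; exact: CBM.
have pc (a : CC R) : p (fun=> a) = a.
  by rewrite -[RHS]mulr1 -chif0 -chiZ.
have pC0 f : C0 R X f -> p f = chi f.
  by move=> Cf; rewrite /p chi_mul// chif0 mulr1.
pose B h := [set x | modulus (h x) < 1].
pose F := filter_from [set h | CB R X h /\ p h = 0] B.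
have FF : ProperFilter F.
  apply: filter_from_proper; last first.
    move=> h [Ch ph]; apply: contrapT => hB.
    have h1 x : 1 <= modulus (h x).
      by rewrite leNgt; apply/negP => hx; apply: hB; exists x.
    have h0 x : h x != 0.
      by apply/eqP => hx; have := h1 x; rewrite hx modulus0 ler10.
    have Cg : CB R X (fun x => (h x)^-1).
      apply/CBP; split.
        move=> x; apply: (@cvgV (CC R)) => //; exact: CB_continuous.
      by exists 1 => x; rewrite modulusV invf_le1// (lt_le_trans _ (h1 x)).
    have := pM _ _ Ch Cg; rewrite ph mul0r.
    rewrite (_ : h * _ = fun=> 1) ?pc; first by move/eqP; rewrite oner_eq0.
    by apply/funext => x; rewrite [LHS]divff.
  apply: filter_from_filter.
    by exists (fun=> 0); split; [exact: CB_cst|exact: pc].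
  move=> g h [Cg pg] [Ch ph].
  (* This is [|g|^2 + |h|^2]: [p] kills it along with [g] and [h], and where it is below 1 so are
     [|g|] and [|h|]. *)
  exists (fun x => g x * (g x)^*%R + h x * (h x)^*%R).
    split; first exact: CB_sum_sqr.
    rewrite (pD (g * fun x => (g x)^*%R) (h * fun x => (h x)^*%R));
      last 2 first.
    - by apply: CBM => //; exact: CB_conj.
    - by apply: CBM => //; exact: CB_conj.
    by rewrite !pM ?pg ?ph ?mul0r ?addr0//; exact: CB_conj.
  move=> x; rewrite /B/= !modulus_mul_conj -rmorphD/= modulus_real.
  rewrite ger0_norm ?addr_ge0 ?sqr_ge0// => gh.
  by split; rewrite /= -(@expr_lt1 _ 2) ?modulus_ge0//; apply: le_lt_trans gh;
    rewrite ?lerDl ?lerDr sqr_ge0.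
have FK : F (superlevel f0 1).
  (* [2 (f0 - 1)] is in the kernel of [p], and where its modulus is below 1, [|f0|] exceeds 1/2, the
     level of index 1. *)
  exists ((fun=> 2) * (f0 + fun=> -1)).
    split; first by apply: CBM; [|apply: CBD]; try exact: CB_cst; case: Cf0.
    rewrite pM ?pD ?pc ?pC0 ?chif0 ?subrr ?mulr0//; try exact: CB_cst.
    - by case: Cf0.
    - by apply: CBD; [case: Cf0|exact: CB_cst].
  move=> x /=; rewrite /B/= modulusM => f0x; apply/superlevelP.
  have m2 : modulus 2 = 2 :> R.
    by rewrite -(rmorph_nat (real_complex R)) modulus_real ger0_norm.
  have : modulus 1 <= modulus (f0 x) + modulus (f0 x - 1).
    rewrite [modulus (_ - 1)]modulusB; apply: le_trans (modulusD _ _).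
    by rewrite addrCA subrr addr0.
  move: f0x; rewrite m2 modulus1 -[(f0 + _) x]/(f0 x - 1).
  move: (modulus (f0 x)) (modulus (f0 x - 1)) => a b; lra.
have [z [_ Fz]] := Cf0.2 1%N F FF FK.
have pz h : CB R X h -> p h = 0 -> h z = 0.
  move=> Ch ph; apply: modulus_eq0; apply/eqP; rewrite -[_ == _]negbK.
  apply/negP => hz; have {}hz : 0 < modulus (h z).
    by rewrite lt_neqAle modulus_ge0 andbT eq_sym.
  (* The function [h / c] is in the kernel too, so [F] contains the set where [|h| < c]. Near [z]
     also [|h z - h| < c], and a common point contradicts [|h z| = 2 c]. *)
  pose c : R := modulus (h z) / 2.
  have c0 : 0 < c by rewrite divr_gt0.
  have FB : F (B ((fun=> (c^-1)%:C%C) * h)).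
    exists ((fun=> (c^-1)%:C%C) * h) => //.
    split; first by apply: CBM => //; exact: CB_cst.
    by rewrite pM ?ph ?mulr0//; exact: CB_cst.
  have nz : nbhs z (h @^-1` [set w | modulus (h z - w) < c]).
    by apply: (CB_continuous Ch); apply/nbhs_modulus; exists c.
  have [x [/=]] := Fz _ _ FB nz; rewrite /B/= modulusM modulus_real.
  rewrite ger0_norm ?invr_ge0 ?(ltW c0)// mulrC ltr_pdivrMr// mul1r => hx hzx.
  have : modulus (h z) <= modulus (h z - h x) + modulus (h x).
    by apply: le_trans (modulusD _ _); rewrite subrK.
  by apply/negP; rewrite -ltNge [ltRHS]splitr -/c ltrD.
exists z => f Cf; apply/esym/eqP; rewrite -subr_eq0; apply/eqP.
(* [f - chi f] is in the kernel of [p], so it vanishes at [z]. *)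
apply: (pz (f + fun=> - chi f)).
  by apply: CBD; [case: Cf|exact: CB_cst].
rewrite pD ?pc ?pC0 ?subrr//; first by case: Cf.
exact: CB_cst.
Qed.

End characters_C0.
End character_theory.

(** * Locally compact spaces as spectra *)

Lemma continuous_ptws (S T : topologicalType) (I : choiceType)
    (f : S -> {ptws I -> T}) :
  (forall i, continuous (fun x => f x i)) -> continuous f.
Proof.
move=> cf x; apply/cvg_sup => i U [_ [[W oW <-]] Wx WU].
have nW : nbhs x ((fun y => f y i) @^-1` W).
  by apply: cf; exact: open_nbhs_nbhs.
by apply: filterS nW => y Wy; apply: WU.
Qed.

(** Complete regularity gives a function vanishing outside the interior of [U] intersected with a
    compact neighborhood [K] of [z]; its superlevel sets are closed subsets of [K]. *)
Lemma C0_separation (R : realType) (Z : topologicalType) (z : Z) (U : set Z) :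
  locally_compact_hausdorff Z -> nbhs z U ->
  exists g : Z -> CC R, [/\ C0 R Z g, g z = 1 & forall w, ~ U w -> g w = 0].
Proof.
move=> [hZ lZ] nU.
have [K zK [cK clK]] := lZ z I.
have nK : nbhs z K := @filterS _ _ (nbhs_filter z) _ _ (fun w Kw => Kw I) zK.
have [|g [Cg gz g0]] := @uniform_separator_CB R Z [set z] (~` (U `&` K)°).
  apply: (@locally_compact_completely_regular _ R lZ hZ).
    exact/open_closedC/open_interior.
  by apply; exact: filterI.
exists g; split; last 2 first.
- exact: gz.
- by move=> w nUw; apply: g0 => /interior_subset[].
split=> // n; apply: subclosed_compact cK _.
  exact/superlevel_closed/CB_continuous.
move=> w /superlevelP gw; apply: contrapT => nKw.
move: gw; rewrite g0 ?modulus0 ?invr_le0 ?lern0//.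
by move=> /interior_subset[].
Qed.

(** A point [z] goes to the character taking [f] to [phi f z]. [C0_separation] makes this map
    injective and an embedding; it is onto by [character_C0_eval], applied to a character composed
    with the inverse of [phi]. *)
Lemma homeomorphic_spectrum (R : realType) (X Z : topologicalType)
    (A : set (X -> CC R)) :
  CB_ideal A -> locally_compact_hausdorff Z ->
  isometrically_isomorphic A (C0 R Z) -> homeomorphic Z (spectrum A).
Proof.
move=> Aid lZ [phi [[phiA phiI phiS] phiD phiZ phiM _]].
have [ACB _ AD AM] := Aid.
have sep z U : nbhs z U -> exists2 f, A f &
    phi f z = 1 /\ forall w, ~ U w -> phi f w = 0.
  move=> /(C0_separation R lZ)[g [/phiS[f Af <-] gz g0]].
  by exists f.
pose ev (z : Z) : {ptws (set_type A) -> CC R} := fun f => phi (set_val f) z.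
have ev_char z : characters (ev z).
  split.
  - have [f Af [fz _]] := sep z setT filterT.
    have [u uf] := in_set_type Af.
    by exists u; rewrite /ev uf fz oner_neq0.
  - move=> a f g h E; rewrite /ev E phiD ?phiZ//; try exact: set_valP.
    by apply: idealZ => //; exact: set_valP.
  - by move=> f g h E; rewrite /ev E phiM//; exact: set_valP.
pose F z : spectrum A := exist _ (ev z) (mem_set (ev_char z)).
apply: (@homeomorphic_embedding _ _ F).
- apply: continuous_set_val; apply: continuous_ptws => f.
  by have [/CB_continuous] : C0 R Z (phi (set_val f)) by apply/phiA/set_valP.
- move=> z w Fzw; apply: contrapT => zw.
  have hZ := hausdorff_accessible lZ.1.
  have nz : nbhs z (~` [set w]).
    apply: open_nbhs_nbhs; split => //.
    exact/closed_openC/accessible_closed_set1.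
  have [f Af [fz fw]] := sep z _ nz.
  have [u uf] := in_set_type Af.
  have : ev z u = ev w u by rewrite -[ev z]/(set_val (F z)) Fzw.
  rewrite /ev uf fz fw; last by apply.
  by move/eqP; rewrite oner_eq0.
- move=> chi.
  have chiA := (characters_ext0 _ Aid).1 (set_valP chi).
  (* [psi] inverts [phi] on [C0 R Z], with the dummy value 0 elsewhere. *)
  have [psi psiA] : exists psi : (Z -> CC R) -> (X -> CC R),
      forall g, C0 R Z g -> A (psi g) /\ phi (psi g) = g.
    have /choice[psi psiP] : forall g, exists f, C0 R Z g -> A f /\ phi f = g.
      move=> g; have [/phiS[f Af fg]|nCg] := pselect (C0 R Z g).
        by exists f.
      by exists 0.
    by exists psi.
  have psiK f : A f -> psi (phi f) = f.
    move=> Af; have [Apf pf] := psiA _ (phiA _ Af).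
    by apply: phiI => //; rewrite inE.
  have [|z zP] := @character_C0_eval R Z (ext0 (set_val chi) \o psi).
    have [[f Af f0] lin mul] := chiA; split.
    + by exists (phi f); [exact: phiA|rewrite /= psiK].
    + move=> a g h /psiA[Ag {1}<-] /psiA[Ah {1}<-] /=.
      rewrite -phiZ// -phiD//; last exact: idealZ.
      by rewrite psiK ?lin//; apply: AD => //; exact: idealZ.
    + move=> g h /psiA[Ag {1}<-] /psiA[Ah {1}<-] /=.
      by rewrite -phiM// psiK ?mul//; apply: AM => //; exact: ACB.
  exists z; apply: set_val_injective; apply/funext => f.
  have Af := set_valP f.
  by have := zP _ (phiA _ Af); rewrite [LHS]/= psiK// ext0_val => ->.
(* The characters not vanishing at [f] form a neighborhood of [F z] whose preimage lies in [U]. *)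
- move=> z U /sep[f Af [fz f0]].
  have [u uf] := in_set_type Af.
  exists ((fun x : spectrum A => set_val x u) @^-1` [set a | a != 0]).
    have cu : continuous (fun x : spectrum A => set_val x u).
      move=> x; apply: (@continuous_comp _ _ _ set_val
          (fun g : {ptws (set_type A) -> CC R} => g u)).
        exact: set_val_continuous.
      exact: (@proj_continuous _ (fun=> CC R)).
    apply: open_nbhs_nbhs; split; first exact: coz_open cu.
    by have : phi (set_val u) z != 0 by rewrite uf fz oner_neq0.
  move=> w Fw; have fw : phi (set_val u) w != 0 by []; rewrite uf in fw.
  by apply: contrapT => /f0 fw0; rewrite fw0 eqxx in fw.
Qed.

(** * The Stone-Cech compactification *)

Section stone_cech_theory.
Variables (R : realType) (X : topologicalType).
Implicit Types (f g : X -> CC R) (y : stone_cech R X).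

(** The continuous extension of [f] to the compactification: the coordinate of index [f] of the
    point [y], or 0 when [f] is not in [CB]. *)
Definition sc_eval f y : CC R := ext0 (set_val y) f.

Lemma sc_eval_incl f x : CB R X f -> sc_eval f (stone_cech_incl R x) = f x.
Proof.
by move=> Cf; have [u <-] := in_set_type Cf; rewrite /sc_eval ext0_val.
Qed.

Lemma sc_eval_continuous f : continuous (sc_eval f).
Proof.
have [Cf|nCf] := pselect (CB R X f); last first.
  rewrite (_ : sc_eval f = fun=> 0); first exact: cst_continuous.
  by apply/funext => y; rewrite /sc_eval /ext0; case: pselect.
have [u uf] := in_set_type Cf.
rewrite (_ : sc_eval f =
  (fun p : {ptws (set_type (CB R X)) -> CC R} => p u) \o set_val).
  move=> y; apply: continuous_comp; first exact: set_val_continuous.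
  exact: (@proj_continuous _ (fun=> CC R)).
by apply/funext => y; rewrite /sc_eval -uf ext0_val.
Qed.

Lemma stone_cech_incl_continuous : continuous (@stone_cech_incl R X).
Proof.
apply: continuous_set_val; apply: continuous_ptws => f.
exact: CB_continuous (set_valP f).
Qed.

Lemma stone_cech_dense y (U : set (stone_cech R X)) :
  nbhs y U -> exists x, U (stone_cech_incl R x).
Proof.
move=> /set_type_nbhs[W nW WU].
have [_ [[x _ <-] Wx]] := set_valP y W nW.
by exists x; apply: WU.
Qed.

(** Density of [X] as an induction principle: equalities and bounds between continuous functions
    need checking on [X] only. *)
Lemma stone_cech_closed_ind (C : set (stone_cech R X)) :
  closed C -> (forall x, C (stone_cech_incl R x)) -> forall y, C y.
Proof.
move=> cC CX y; apply: cC => U /stone_cech_dense[x Ux].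
by exists (stone_cech_incl R x).
Qed.

Lemma stone_cech_eq (a b : stone_cech R X -> CC R) :
  continuous a -> continuous b ->
  (forall x, a (stone_cech_incl R x) = b (stone_cech_incl R x)) -> a =1 b.
Proof.
move=> ca cb ab y; apply/eqP; rewrite -subr_eq0; apply/eqP; move: y.
apply: (@stone_cech_closed_ind ((fun y => a y - b y) @^-1` [set 0]));
  last first.
  by move=> x /=; rewrite ab subrr.
apply: closed_preimage; first exact: continuous_sub.
exact: closed_set1C.
Qed.

Lemma sc_evalD f g : CB R X f -> CB R X g ->
  sc_eval (f + g) =1 (fun y => sc_eval f y + sc_eval g y).
Proof.
move=> Cf Cg; apply: stone_cech_eq; first exact: sc_eval_continuous.
  by apply: continuous_add; exact: sc_eval_continuous.
by move=> x; rewrite !sc_eval_incl//; exact: CBD.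
Qed.

Lemma sc_evalM f g : CB R X f -> CB R X g ->
  sc_eval (f * g) =1 (fun y => sc_eval f y * sc_eval g y).
Proof.
move=> Cf Cg; apply: stone_cech_eq; first exact: sc_eval_continuous.
  by apply: continuous_mul; exact: sc_eval_continuous.
by move=> x; rewrite !sc_eval_incl//; exact: CBM.
Qed.

Lemma sc_eval_cst (a : CC R) : sc_eval (fun=> a) =1 (fun=> a).
Proof.
apply: stone_cech_eq; first exact: sc_eval_continuous.
  exact: cst_continuous.
by move=> x; rewrite sc_eval_incl//; exact: CB_cst.
Qed.

Lemma modulus_sc_eval f (M : R) y : CB R X f ->
  (forall x, modulus (f x) <= M) -> modulus (sc_eval f y) <= M.
Proof.
move=> Cf fM; move: y.
apply: (@stone_cech_closed_ind
  ((@modulus R \o sc_eval f) @^-1` [set a | a <= M])).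
  apply: closed_preimage; last exact: closed_le.
  exact/continuous_modulus/sc_eval_continuous.
by move=> x /=; rewrite sc_eval_incl.
Qed.

Lemma stone_cech_hausdorff : hausdorff_space (stone_cech R X).
Proof.
apply: hausdorff_injective (@set_val_injective _ _) _.
  exact: set_val_continuous.
by apply: hausdorff_product => _; exact: norm_hausdorff.
Qed.

(** The image of [X] lies in a product of discs, one for each [f] in [CB] with a bound of [f] as
    radius. The product is compact by Tychonoff and closed, so it contains the closure. *)
Lemma stone_cech_compact : compact [set: stone_cech R X].
Proof.
have /choice[M MP] : forall f : set_type (CB R X), exists M : R,
    forall x, modulus ((set_val f : X -> CC R) x) <= M.
  by move=> f; exact: CB_bounded (set_valP f).
pose D := [set p : {ptws (set_type (CB R X)) -> CC R} |
  forall u, [set z | modulus z <= M u] (p u)].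
have cD : compact D.
  exact: (@tychonoff (set_type (CB R X)) (fun=> CC R)
    (fun u => [set z | modulus z <= M u]) (fun u => @compact_disc R (M u))).
have clD : closed D.
  apply: compact_closed cD.
  by apply: hausdorff_product => _; exact: norm_hausdorff.
have rD : closure (range (@stone_cech_eval R X)) `<=` D.
  rewrite (closure_id D).1//; apply: closureS => _ [x _ <-] f.
  exact: MP.
have cR := subclosed_compact (@closed_closure _ _) cD rD.
have := compact_set_type cR (@subset_refl _ _).
rewrite (_ : _ @^-1` _ = setT)//.
by apply/seteqP; split=> // y _; exact: set_valP.
Qed.

End stone_cech_theory.

(** * The space lambda X *)

Section lambda.
Variables (R : realType) (P Q : topologicalType -> Prop).
Hypothesis P_prop : topological_property P.
Hypotheses (P_hered : closed_hereditary P) (Q_hered : closed_hereditary Q).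
Hypothesis PQ_lindelof : forall T : topologicalType, P T -> Q T -> lindelof T.
Hypothesis P_sums : countable_closed_sums P.
Hypothesis PQ_dense : forall (T : topologicalType) (D : set T),
  Q T -> dense D -> P (set_type D) -> P T.
Variable X : topologicalType.
Hypotheses (X_locP : locally_prop P X) (X_Q : Q X).
Hypotheses (X_hausdorff : hausdorff_space X) (X_normal : normal_space X).
Implicit Types (f g : X -> CC R) (B : set X).

Notation A := (C0P R X P).
Notation Y := (set_type (lambdaP R X P)).

Let X_regular : regular_space X.
Proof.
apply: (@completely_regular_regular R).
apply: (@normal_completely_regular R) => //.
exact: hausdorff_accessible.
Qed.

Let nullS B (C : set X) : B `<=` C -> null P C -> null P B.
Proof. exact: null_subset. Qed.

Let nullUB B (C : set X) : null P B -> null P C -> null P (B `|` C).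
Proof. exact: (@nullU P Q). Qed.

Let null_bigcupB (I : Type) (D : set I) (F : I -> set X) : countable D ->
  (forall i, D i -> null P (F i)) -> null P (\bigcup_(i in D) F i).
Proof. exact: (@null_bigcup P Q). Qed.

Lemma C0PP f : A f <-> CB R X f /\ null P (coz f).
Proof. by rewrite (@C0P_supp P Q). Qed.

Lemma C0P_ideal : CB_ideal A.
Proof.
split.
- by move=> f [].
- apply/C0PP; split; first exact: CB_cst.
  rewrite (_ : coz _ = set0); first exact: (@null0 P Q).
  by apply/seteqP; split=> // x; rewrite /coz/= eqxx.
- move=> f g /C0PP[Cf Pf] /C0PP[Cg Pg]; apply/C0PP; split; first exact: CBD.
  apply: nullS (nullUB Pf Pg) => x; rewrite /coz/= -[(f + g) x]/(f x + g x).
  by have [->|fx] := eqVneq (f x) 0; [rewrite add0r; right|left].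
- move=> f g Cf /C0PP[Cg Pg]; apply/C0PP; split; first exact: CBM.
  apply: nullS Pg => x; apply: contraNneq => gx.
  by rewrite -[_ x]/(f x * g x) gx mulr0.
Qed.

Let AM f g : CB R X f -> A g -> A (f * g).
Proof. by case: C0P_ideal => _ _ _; apply. Qed.

Let ACB f : A f -> CB R X f.
Proof. by case. Qed.

(** If [g] in [A] is closer to [f] than [1/(n+1)], then [superlevel f n] lies in the null set
    [coz g]. *)
Lemma C0P_closed : CB_closed A.
Proof.
move=> f Cf fA; split => // n.
have [|g Ag fg] := fA n.+1%:R^-1; first by rewrite invr_gt0.
have /C0PP[Cg Pg] := Ag.
apply: nullS Pg => x /superlevelP nfx; apply/eqP => gx.
have Cfg : CB R X (f - g).
  have := CBD Cf (CBM (CB_cst X (-1)) Cg); congr CB; apply/funext => z.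
  by rewrite -[LHS]/(f z + -1 * g z) mulN1r.
have [_ /(_ x)] := (supnorm_leP (supnorm (f - g)) Cfg).1 (lexx _).
rewrite -[(f - g) x]/(f x - g x) gx subr0 => /le_lt_trans /(_ fg).
by rewrite ltNge nfx.
Qed.

Lemma null_nbhd_bump B : closed B -> has_null_nbhd P B ->
  exists2 f, A f & forall x, B x -> f x = 1.
Proof.
move=> cB [U /set_nbhsP[C [oC BC CU]] PU].
have [|f [Cf f1 f0]] := @uniform_separator_CB R X B (~` C).
  apply: (@normal_separatorP R X).1 => //; first exact: open_closedC.
  by apply/disjoints_subset; rewrite setCK.
exists f => //; apply/C0PP; split=> //; apply: nullS PU => x fx; apply: CU.
by apply: contrapT => /f0 fx0; move: fx; rewrite /coz/= fx0 eqxx.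
Qed.

(** With [B] the cozero-set of some [g] in [A], this gives a local unit: an [f] in [A] with
    [f * g = g]. *)
Lemma null_bump B : null P B -> exists2 f, A f & forall x, B x -> f x = 1.
Proof.
move=> PB; have [|f Af f1] := @null_nbhd_bump (closure B) (@closed_closure _ _).
  by apply: (@closed_prop_null_nbhd P Q) => //; exact: closed_closure.
by exists f => // x Bx; apply/f1/subset_closure.
Qed.

Lemma point_bump x : exists2 f, A f & f x = 1.
Proof.
have [U nU PU] := X_locP x.
have [V nV VU] := X_regular nU.
have [|f Af f1] := @null_bump [set x].
  apply: (closed_subset_prop P_prop P_hered _ _ PU).
    exact: closed_closure.
  by apply: subset_trans VU; apply: closureS => _ ->; exact: nbhs_singleton.
by exists f => //; exact: f1.
Qed.

Lemma lambdaPP y : lambdaP R X P y <-> exists2 f, A f & sc_eval f y != 0.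
Proof.
split.
  move=> [C [_ [U nU PU]]] /interior_subset yC.
  have [|f Af f1] := @null_nbhd_bump (closure C) (@closed_closure _ _).
    by exists U.
  (* [f] is 1 on [C], so its extension is 1 on the closure of [C] in the compactification, where [y]
     lies. *)
  exists f => //; suff -> : sc_eval f y = 1 by rewrite oner_neq0.
  have clD : closed (sc_eval f @^-1` [set 1 : CC R]).
    exact: closed_preimage (@sc_eval_continuous R X f) (@closed_set1C R 1).
  have : closure (@stone_cech_incl R X @` C) `<=` sc_eval f @^-1` [set 1].
    rewrite ((closure_id _).1 clD); apply: closureS => _ [x Cx <-].
    rewrite /preimage/= sc_eval_incl ?f1//; first exact: subset_closure.
    exact: ACB.
  exact.
move=> [f Af fy]; have /C0PP[Cf Pf] := Af.
exists (coz f).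
  split; first by exists f => //; exact: CB_continuous.
  by apply: (@closed_prop_null_nbhd P Q) => //; exact: closed_closure.
have oC := coz_open (@sc_eval_continuous R X f).
(* The open set where [sc_eval f] is non-zero contains [y] and, as [X] is dense, lies in the closure
   of [coz f]. *)
apply: filterS (open_nbhs_nbhs (conj oC fy)).
move=> z fz U nU.
have [x [Ux fx]] : exists x,
    U (stone_cech_incl R x) /\ coz (sc_eval f) (stone_cech_incl R x).
  apply: (@stone_cech_dense R X z (U `&` coz (sc_eval f))).
  by apply: filterI => //; apply: open_nbhs_nbhs.
exists (stone_cech_incl R x); split => //; exists x => //.
by move: fx; rewrite /coz/= sc_eval_incl.
Qed.

Lemma lambdaP_incl x : lambdaP R X P (stone_cech_incl R x).
Proof.
have [f Af fx] := point_bump x.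
apply/lambdaPP; exists f => //.
by rewrite sc_eval_incl ?fx ?oner_neq0//; exact: ACB.
Qed.

Let iota x : Y := exist _ (stone_cech_incl R x) (mem_set (lambdaP_incl x)).

Definition lambda_eval f : Y -> CC R := fun y => sc_eval f (set_val y).

Let phi := lambda_eval.

Lemma lambda_eval_continuous f : continuous (phi f).
Proof.
move=> y; apply: (@continuous_comp _ _ _ set_val (sc_eval f)).
  exact: set_val_continuous.
exact: sc_eval_continuous.
Qed.

Let phi_iota f x : A f -> phi f (iota x) = f x.
Proof. by move=> Af; rewrite /phi /lambda_eval sc_eval_incl//; exact: ACB. Qed.

(** The level set of the extension is compact in the whole compactification, and by [lambdaPP] it
    already lies in lambda X because [c] is positive. *)
Lemma lambda_eval_level_compact f (c : R) : A f -> 0 < c ->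
  compact [set y : Y | c <= modulus (phi f y)].
Proof.
move=> Af c0.
apply: (@compact_set_type _ (lambdaP R X P)
  [set z | c <= modulus (sc_eval f z)]).
  apply: subclosed_compact (@stone_cech_compact R X) _ => //.
  apply: (@closed_preimage _ _ (fun z => modulus (sc_eval f z))
    [set a | c <= a]); last exact: closed_ge.
  exact/continuous_modulus/sc_eval_continuous.
move=> z /= cz; apply/lambdaPP; exists f => //; apply/eqP => fz.
by move: cz; rewrite fz modulus0 leNgt c0.
Qed.

Lemma lambda_hausdorff : hausdorff_space Y.
Proof.
apply: hausdorff_injective (@set_val_injective _ _) (@stone_cech_hausdorff R X).
exact: set_val_continuous.
Qed.

Lemma lambda_locally_compact : locally_compact_hausdorff Y.
Proof.
split; first exact: lambda_hausdorff.
move=> y _; have [f Af fy] := (lambdaPP _).1 (set_valP y).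
(* At half the value, the level set is a neighborhood of [y]. *)
pose c : R := modulus (phi f y) / 2.
have fy0 : 0 < modulus (phi f y).
  rewrite lt_neqAle modulus_ge0 andbT eq_sym.
  by apply: contra fy => /eqP/modulus_eq0/eqP.
have c0 : 0 < c by rewrite divr_gt0.
have cK := lambda_eval_level_compact Af c0.
exists [set y' : Y | c <= modulus (phi f y')].
  have : nbhs y ((@modulus R \o phi f) @^-1` [set a | c < a]).
    apply: open_nbhs_nbhs; split.
      apply: open_preimage; last exact: open_gt.
      exact/continuous_modulus/lambda_eval_continuous.
    by rewrite /preimage/= ltr_pdivrMr// ltr_pMr// ltr1n.
  by apply: filterS => z /ltW cz _.
by split => //; apply: compact_closed => //; exact: lambda_hausdorff.
Qed.

(** * Extension to lambda X as an isometric isomorphism *)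

Lemma lambda_eval_CB f : CB R X f -> CB R Y (phi f).
Proof.
move=> Cf; apply/CBP; split; first exact: lambda_eval_continuous.
by have [M fM] := CB_bounded Cf; exists M => y; exact: modulus_sc_eval.
Qed.

Lemma lambda_eval_C0 f : A f -> C0 R Y (phi f).
Proof.
move=> Af; split; first exact/lambda_eval_CB/ACB.
move=> n; have := @lambda_eval_level_compact f n.+1%:R^-1 Af.
rewrite (_ : superlevel _ n = [set y | n.+1%:R^-1 <= modulus (phi f y)]).
  by apply; rewrite invr_gt0.
by apply/seteqP; split=> y /superlevelP.
Qed.

Lemma supnorm_lambda_eval f : A f -> supnorm (phi f) = supnorm f.
Proof.
move=> Af; have Cf := ACB Af; have Cpf := lambda_eval_CB Cf.
apply/eqP; rewrite eq_le; apply/andP; split.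
  have [f0 fle] := (supnorm_leP (supnorm f) Cf).1 (lexx _).
  by apply/(supnorm_leP _ Cpf); split=> // y; exact: modulus_sc_eval.
have [f0 fle] := (supnorm_leP (supnorm (phi f)) Cpf).1 (lexx _).
by apply/(supnorm_leP _ Cf); split=> // x; rewrite -phi_iota.
Qed.

Lemma lambda_eval_surj (g : Y -> CC R) : C0 R Y g -> exists2 f, A f & phi f = g.
Proof.
move=> [Cg cg].
have ciota : continuous iota.
  apply: continuous_set_val; exact: stone_cech_incl_continuous.
have Cf : CB R X (g \o iota).
  apply/CBP; split.
    by move=> x; apply: continuous_comp; [exact: ciota|exact: CB_continuous].
  by have [M gM] := CB_bounded Cg; exists M => x; exact: gM.
exists (g \o iota).
  split=> // n.
  have : null P (iota @^-1` superlevel g n).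
    (* The subsets of [Y] with null trace on [X] form an ideal, and each point has a neighborhood
       [coz (phi f)] in it, with trace [coz f]. *)
    apply: (@compact_ideal Y [set K | null P (iota @^-1` K)] _ _ _ _ (cg n)).
    - by rewrite /= preimage_set0; exact: (@null0 P Q).
    - by move=> K L KL; apply: nullS => x; exact: KL.
    - by move=> K L; rewrite /= preimage_setU; exact: nullUB.
    - move=> y _; have [f Af fy] := (lambdaPP _).1 (set_valP y).
      exists (coz (phi f)).
        apply: open_nbhs_nbhs; split=> //.
        exact/coz_open/lambda_eval_continuous.
      have /C0PP[_] := Af; apply: nullS => x.
      by rewrite /preimage /coz /= phi_iota.
  by [].
(* Both sides are continuous and agree on the image of [iota], which is dense in [Y]. *)
apply/funext => y; apply/eqP; rewrite -subr_eq0; apply/eqP.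
have : closed ((fun y => phi (g \o iota) y - g y) @^-1` [set 0]).
  apply: closed_preimage; last exact: closed_set1C.
  apply: continuous_sub; first exact: lambda_eval_continuous.
  exact: CB_continuous.
apply=> U /set_type_nbhs[W nW WU].
have [x Wx] := stone_cech_dense nW.
exists (iota x); split; last exact: WU.
by rewrite /preimage /= /phi /lambda_eval sc_eval_incl//= subrr.
Qed.

Lemma lambda_iso : isometrically_isomorphic A (C0 R Y).
Proof.
have [_ _ AD _] := C0P_ideal.
exists phi; split.
- split.
  + exact: lambda_eval_C0.
  + move=> f g; rewrite !inE => Af Ag fg; apply/funext => x.
    by rewrite -!phi_iota// fg.
  + by move=> g /lambda_eval_surj[f Af fg]; exists f.
- by move=> f g Af Ag; apply/funext => y; apply: sc_evalD; exact: ACB.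
- move=> a f Af; apply/funext => y.
  (* Scaling is multiplication by a constant function. *)
  rewrite -[phi _]/(phi ((fun=> a) * f)) /phi /lambda_eval.
  rewrite sc_evalM ?sc_eval_cst//.
    exact: CB_cst.
  exact: ACB.
- by move=> f g Af Ag; apply/funext => y; apply: sc_evalM; exact: ACB.
- exact: supnorm_lambda_eval.
Qed.

(** * Units, and compactness properties of lambda X *)

Lemma null_setT : null P [set: X] <-> P X.
Proof.
rewrite /null closureT; split; apply: P_prop.2.
  exact: homeomorphic_setT.
exact/homeomorphic_sym/homeomorphic_setT.
Qed.

(** The identity [h * f = f] extends from [X] to [y], where the factor [phi f y] cancels. *)
Let bump_eval h f (y : Y) : A h -> A f -> (forall x, coz f x -> h x = 1) ->
  phi f y != 0 -> phi h y = 1.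
Proof.
move=> Ah Af h1 fy; apply: (mulIf fy); rewrite mul1r /phi /lambda_eval.
rewrite -sc_evalM; [congr sc_eval|exact: ACB..].
apply/funext => x; rewrite -[LHS]/(h x * f x).
by have [->|/h1->] := eqVneq (f x) 0; rewrite ?mulr0 ?mul1r.
Qed.

(** Write [g] as [phi f] and take [h] in [A] equal to 1 on [coz f]. Then [supp g] lies in the
    compact set where [|phi h| >= 1]. *)
Lemma lambda_C0_C00 : C0 R Y = C00 R Y.
Proof.
apply/seteqP; split=> g [Cg cg]; split => //; last first.
  move=> n; apply: subclosed_compact cg (@superlevel_supp _ _ g n).
  exact/superlevel_closed/CB_continuous.
have [f Af fg] := lambda_eval_surj (conj Cg cg); have /C0PP[_ Pf] := Af.
have [h Ah h1] := null_bump Pf.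
have cK := lambda_eval_level_compact Ah ltr01.
apply: (subclosed_compact (@closed_closure _ _) cK).
rewrite ((closure_id _).1 (compact_closed lambda_hausdorff cK)).
apply: closureS => y; rewrite /coz/= -fg => fy.
by rewrite (bump_eval Ah Af h1 fy) modulus1.
Qed.

Lemma lambda_sequence_compact (u : nat -> Y) :
  exists2 K : set Y, compact K & forall n, K (u n).
Proof.
have /choice[h hP] : forall n, exists f, A f /\ phi f (u n) != 0.
  by move=> n; have [f Af fn] := (lambdaPP _).1 (set_valP (u n)); exists f.
have [|f Af f1] := @null_bump (\bigcup_n coz (h n)).
  by apply: null_bigcupB => // n _; have [/C0PP[]] := hP n.
exists [set y : Y | 1 <= modulus (phi f y)].
  exact: lambda_eval_level_compact.
move=> n; have [Ah hn] := hP n.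
rewrite /= (bump_eval Af Ah _ hn) ?modulus1// => x hx.
by apply: f1; exists n.
Qed.

(** If no finite subfamily covers, choose [u n] outside all members of [G] of index at most [n]. The
    sequence lies in a compact set and so has a cluster point; a member [S] containing it would meet
    the tail from [e S] on, which avoids [S]. *)
Lemma lambda_countably_compact : countably_compact Y.
Proof.
move=> G /countable_injP[e eI] [Go GT]; apply: contrapT => nG.
pose H n := [set S | G S /\ (e S <= n)%N].
have Hfin n : finite_set (H n).
  have eH : {in H n &, injective e}.
    by move=> S T /set_mem[GS _] /set_mem[GT' _]; apply: eI; exact: mem_set.
  rewrite -(eq_finite_set (inj_card_eq eH)).
  by apply: sub_finite_set (finite_II n.+1) => _ [S [_ eS] <-].
have /choice[u uP] : forall n, exists y : Y, forall S, H n S -> ~ S y.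
  move=> n; apply: contrapT => nu; apply: nG; exists (H n); split => //.
    by move=> S [].
  split; first by move=> S [/Go].
  apply/seteqP; split=> // y _; apply: contrapT => ny; apply: nu; exists y.
  by move=> S HS Sy; apply: ny; exists S.
have [K cK Ku] := lambda_sequence_compact u.
have [y [_ Fy]] : K `&` cluster (u @ \oo) !=set0.
  by apply: cK; exists 0%N => // n _; exact: Ku.
have [S GS Sy] : (\bigcup_(S in G) S) y by rewrite GT.
have nS := open_nbhs_nbhs (conj (Go _ GS) Sy).
have [|z [[n eSn <-]]] := Fy (u @` [set n | (e S <= n)%N]) S _ nS.
  by exists (e S) => // n eSn; exists n.
exact: (uP n).
Qed.

(** Each point has a function of [A] with value 1 there, so a unit equals 1 everywhere and its
    cozero-set is [X]. *)
Lemma unital_C0P : unital A <-> P X.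
Proof.
split=> [[u Au u1]|PX].
  apply/null_setT; have /C0PP[_] := Au; apply: nullS => x _.
  have [f Af fx] := point_bump x.
  have /(congr1 (fun f : X -> CC R => f x)) := u1 _ Af.
  rewrite -[(u * f) x]/(u x * f x) fx mulr1 /coz/= => ->.
  exact: oner_neq0.
exists (fun=> 1); last by move=> f _; exact: mul1r.
apply/C0PP; split; first exact: CB_cst.
exact: nullS (@subsetT _ _) (null_setT.2 PX).
Qed.

(** Both conditions say that the constant 1 is in the algebra: in [A], where its level set is all of
    [Y], or in [C0 R Y], whence it comes from a function equal to 1 on [X]. *)
Lemma lambda_compact : P X <-> compact [set: Y].
Proof.
split=> [PX|cY].
  have A1 : A (fun=> 1).
    apply/C0PP; split; first exact: CB_cst.
    exact: nullS (@subsetT _ _) (null_setT.2 PX).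
  have := lambda_eval_level_compact A1 ltr01.
  rewrite (_ : [set y | _] = setT)//; apply/seteqP; split=> // y _ /=.
  by rewrite /phi /lambda_eval sc_eval_cst modulus1.
have C1 : C0 R Y (fun=> 1).
  split=> [|n]; first exact: CB_cst.
  apply: subclosed_compact cY _ => //; apply: superlevel_closed.
  exact: cst_continuous.
have [u Au u1] := lambda_eval_surj C1.
apply/null_setT; have /C0PP[_] := Au; apply: nullS => x _.
by rewrite /coz/= -phi_iota// u1 oner_neq0.
Qed.

End lambda.

Theorem theorem3p3p10 (R : realType) (P Q : topologicalType -> Prop)
  (P_prop : topological_property P) (Q_prop : topological_property Q)
  (P_hered : closed_hereditary P) (Q_hered : closed_hereditary Q)
  (PQ_lindelof : forall T : topologicalType, P T -> Q T -> lindelof T)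
  (P_sums : countable_closed_sums P)
  (PQ_dense : forall (T : topologicalType) (D : set T),
     Q T -> dense D -> P (set_type D) -> P T)
  (X : topologicalType) (X_locP : locally_prop P X) (X_Q : Q X) :
  (@regular_space X ->
     C0P R X P = [set f | CB R X f /\ P (set_type (supp f))] /\
     [set f | CB R X f /\ P (set_type (supp f))] = C00P R X P) /\
  (hausdorff_space X -> @normal_space X ->
     let Y : topologicalType := set_type (lambdaP R X P) in
     [/\ CB_ideal (C0P R X P) /\ CB_closed (C0P R X P),
         locally_compact_hausdorff Y /\
           isometrically_isomorphic (C0P R X P) (C0 R Y),
         (forall Z : topologicalType, locally_compact_hausdorff Z ->
            isometrically_isomorphic (C0P R X P) (C0 R Z) ->
            homeomorphic Z Y),
         homeomorphic Y (spectrum (C0P R X P)) &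
         [/\ countably_compact Y,
             C0 R Y = C00 R Y,
             (unital (C0P R X P) <-> P X) &
             (P X <-> compact [set: Y])]]).
Proof.
split=> [Xreg|X_hausdorff X_normal Y].
  by rewrite (@C0P_supp P Q)// (@C00P_supp P Q).
have Aid : CB_ideal (C0P R X P) by exact: (@C0P_ideal R P Q).
have Ylc : locally_compact_hausdorff Y.
  exact: (@lambda_locally_compact R P Q).
have AY : isometrically_isomorphic (C0P R X P) (C0 R Y).
  exact: (@lambda_iso R P Q).
have YS := homeomorphic_spectrum Aid Ylc AY.
split=> //.
- by split=> //; exact: (@C0P_closed R P Q).
(* Both [Z] and [Y] are homeomorphic to the spectrum. *)
- move=> Z Zlc AZ; apply: homeomorphic_trans (homeomorphic_sym YS).
  exact: homeomorphic_spectrum AZ.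
- split.
  + exact: (@lambda_countably_compact R P Q).
  + exact: (@lambda_C0_C00 R P Q).
  + exact: (@unital_C0P R P Q).
  + exact: (@lambda_compact R P Q).
Qed.
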